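(* Let $(E_1,\mathscr{E}_1,\mu_1),\dots,(E_n,\mathscr{E}_n,\mu_n)$ and $(F,\mathscr{F},\nu)$ be Polish measure spaces. For each $i$ let $\mathcal{A}_i\subseteq\mathscr{E}_i$ be a collection of analytic sets containing the empty set. Let $\alpha\le1$, let $t=(t_1,\dots,t_n)$ with $t_i>0$ and $\sum_{i=1}^nt_i=1$, let $p=(p_1,\dots,p_n)\in[1,\infty)^n$, and let $\square$ be a generalized sup-convolution for these data. Then $$\int_F\square a\,d\nu\ \ge\ \mathcal{M}^{(t)}_\alpha\left(\|a_1\mathbbm{1}_{A_1}\|_{p_1},\dots,\|a_n\mathbbm{1}_{A_n}\|_{p_n}\right)$$ holds for all $a=(a_1\mathbbm{1}_{A_1},\dots,a_n\mathbbm{1}_{A_n})$ with $a_i\in(0,\infty)$ and $A_i\in\mathcal{A}_i$, if and only if $$\nu_*(\square f)\ \ge\ \mathcal{M}^{(t)}_\alpha\left(\|f_1\|_{p_1},\dots,\|f_n\|_{p_n}\right)$$ holds for all $f=(f_1,\dots,f_n)$ with non-negative $f_i\in L_{p_i}(\mu_i)\cap\mathcal{F}(\mathcal{A}_i)$.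
   Context: A set is analytic if it is the continuous image of a Polish space (or empty). $\|f_i\|_{p_i}=\left(\int|f_i|^{p_i}\,d\mu_i\right)^{1/p_i}$. $\nu_*$ is the lower integral: $\nu_*(\phi)=\sup\{\int s\,d\nu:\ s\le\phi,\ s\text{ a non-negative measurable simple function}\}$. For $u\in(0,\infty)^n$ and $p\in\mathbb{R}\setminus\{0\}$, $\mathcal{M}^{(t)}_p(u)=\left(\sum_i t_iu_i^p\right)^{1/p}$; $\mathcal{M}^{(t)}_0(u)=\prod_iu_i^{t_i}$; $\mathcal{M}^{(t)}_{-\infty}(u)=\min_iu_i$. If $u\in[0,\infty)^n$ has some $u_i=0$, then $\mathcal{M}^{(t)}_p(u)=0$. For non-negative functions, $f_i\in\mathcal{F}(\mathcal{A}_i)$ means $f_i:E_i\to[0,\infty)$ and $\{f_i\ge s\}\in\mathcal{A}_i$ for all $s>0$. A generalized sup-convolution is a map $\square$ taking each tuple $f=(f_1,\dots,f_n)$ of non-negative $f_i\in\mathcal{F}(\mathcal{A}_i)$ to a function $\square f:F\to[0,\infty]$ such that, for non-negative $f_i,g_i\in\mathcal{F}(\mathcal{A}_i)$: (1) if $f_i\le g_i$ for all $i$, then $\square f\le\square g$ pointwise; (2) if for each $i$, $g_i(x)>0$ implies $f_i(x)\ge f_i(y)$ for all $y\in E_i$, then $\square(f+g)\ge\square f+\square g$ pointwise, where $f+g=(f_1+g_1,\dots,f_n+g_n)$; (3) if $s=(a_1\mathbbm{1}_{A_1},\dots,a_n\mathbbm{1}_{A_n})$ with $A_i\in\mathcal{A}_i$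 and $a_i\ge0$, then $\square s$ is $\mathscr{F}$-measurable.
   Formalization: The inequality for indicators is required only for those tuples whose norms ‖a_i 1_{A_i}‖_{p_i} are all finite, since the mean is defined only for finite arguments and the equivalence fails if infinite norms are admitted with mean ∞. *)

(* Defs.v *)
From HB Require Import structures.
From mathcomp Require Import all_boot all_order all_algebra.
From mathcomp Require Import all_classical all_reals all_analysis.
From mathcomp Require Import measurable_realfun.

Set Implicit Arguments.
Unset Strict Implicit.
Unset Printing Implicit Defensive.

Import Order.TTheory GRing.Theory Num.Theory.
Import numFieldNormedType.Exports.
Import HBNNSimple.

Local Open Scope classical_set_scope.
Local Open Scope ring_scope.

(* A carrier with both a topology and a sigma-algebra, with no compatibility
   between the two: see polish_measurable. *)
#[short(type="topMeasurableType")]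
HB.structure Definition TopMeasurable d :=
  {T of Topological T & Measurable d T}.

Definition is_metric (R : realType) (T : Type) (dist : T -> T -> R) : Prop :=
  [/\ forall x y, dist x y = 0 <-> x = y,
      forall x y, dist x y = dist y x
    & forall x y z, dist x z <= dist x y + dist y z].

Definition induces_topology (R : realType) (T : topologicalType)
    (dist : T -> T -> R) : Prop :=
  forall U : set T, open U <->
    forall x, U x -> exists2 e : R, 0 < e & [set y | dist x y < e] `<=` U.

Definition metric_complete (R : realType) (T : topologicalType)
    (dist : T -> T -> R) : Prop :=
  forall u : nat -> T,
    (forall e : R, 0 < e -> exists N : nat, forall j k : nat,
        (N <= j)%N -> (N <= k)%N -> dist (u j) (u k) < e) ->
    exists l : T, u @ \oo --> l.

Definition polish (R : realType) (T : topologicalType) : Prop :=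
  (exists2 D : set T, countable D & dense D) /\
  (exists dist : T -> T -> R,
     [/\ is_metric dist, induces_topology dist & metric_complete dist]).

(* Only "Borel sets are measurable" is required, so that both the Borel
   sigma-algebra and its completions (which contain non-Borel analytic sets)
   are covered. *)
Definition polish_measurable (R : realType) d (T : topMeasurableType d) :
    Prop :=
  polish R T /\ (forall U : set T, open U -> measurable U).

Definition analytic (R : realType) (T : topologicalType) (A : set T) : Prop :=
  A = set0 \/
  exists (P : topologicalType) (g : P -> T),
    [/\ polish R P, continuous g & A = range g].

(* The mean of exponent al in [-oo, +oo[ of a vector u of non-negative reals;
   inf (range u) is the minimum of the u i as soon as 0 < n. The value at
   al = +oo is the usual one but is never used. *)
Definition wmean (R : realType) (n : nat) (t : 'I_n -> R) (al : \bar R)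
    (u : 'I_n -> R) : R :=
  if [exists i, u i == 0] then 0
  else match al with
       | r%:E => if r == 0 then \prod_(i < n) u i `^ t i
                 else (\sum_(i < n) t i * u i `^ r) `^ r^-1
       | -oo%E => inf (range u)
       | +oo%E => sup (range u)
       end.

Definition lower_integral d (T : measurableType d) (R : realType)
    (nu : {measure set T -> \bar R}) (phi : T -> \bar R) : \bar R :=
  ereal_sup [set (\int[nu]_x (s x)%:E)%E | s in
    [set s : {nnsfun T >-> R} | forall x, ((s x)%:E <= phi x)%E]].

Definition superlevel_in (R : realType) (T : Type) (A : set (set T))
    (f : T -> R) : Prop :=
  (forall x, 0 <= f x) /\ (forall s : R, 0 < s -> A [set x | s <= f x]).

Definition indic_tuple (R : realType) (n : nat) (E : 'I_n -> Type)
    (a : 'I_n -> R) (X : forall i, set (E i)) : forall i, E i -> R :=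
  fun i x => a i * \1_(X i) x.
Arguments indic_tuple {R n E} a X i x.

(* The map sq is only constrained on tuples of non-negative functions with
   superlevel sets in the A i; its values elsewhere are irrelevant. *)
Record gen_sup_convolution (R : realType) (n : nat)
    (dE : 'I_n -> measure_display) (E : forall i, measurableType (dE i))
    (dF : measure_display) (F : measurableType dF)
    (A : forall i, set (set (E i)))
    (sq : (forall i, E i -> R) -> F -> \bar R) : Prop := {
  gsc_ge0 : forall f : forall i, E i -> R,
    (forall i, superlevel_in (A i) (f i)) ->
    forall z, (0 <= sq f z)%E ;
  gsc_mono : forall f g : forall i, E i -> R,
    (forall i, superlevel_in (A i) (f i)) ->
    (forall i, superlevel_in (A i) (g i)) ->
    (forall i x, f i x <= g i x) ->
    forall z, (sq f z <= sq g z)%E ;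
  gsc_superadd : forall f g : forall i, E i -> R,
    (forall i, superlevel_in (A i) (f i)) ->
    (forall i, superlevel_in (A i) (g i)) ->
    (forall i x, 0 < g i x -> forall y, f i y <= f i x) ->
    forall z, (sq f z + sq g z <= sq (fun i x => f i x + g i x)%R z)%E ;
  gsc_meas : forall (a : 'I_n -> R) (X : forall i, set (E i)),
    (forall i, 0 <= a i) -> (forall i, A i (X i)) ->
    measurable_fun setT (sq (indic_tuple a X))
}.

(* Main.v *)
Require Import Defs.
From HB Require Import structures.
From mathcomp Require Import all_boot all_order all_algebra.
From mathcomp Require Import all_classical all_reals all_analysis.
From mathcomp Require Import measurable_realfun lra.

Set Implicit Arguments.
Unset Strict Implicit.
Unset Printing Implicit Defensive.

Import Order.TTheory GRing.Theory Num.Theory.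
Import numFieldNormedType.Exports.

Local Open Scope classical_set_scope.
Local Open Scope ring_scope.

(** The implication from functions to indicators holds because [sq] of a tuple
of indicators is non-negative, and for non-negative functions the lower
integral has the same defining supremum as the integral.

For the converse, cut each [f i] along finitely many levels
[0 = s i 0 < s i 1 < ... < s i M]: the sum over [k] of the layers
[(s i k.+1 - s i k) * \1_(f i >= s i k.+1)] is at most [f i], and its
non-empty superlevel sets are superlevel sets of [f i].  The lower layers are constant
and maximal wherever the next one is positive, so superadditivity applies
repeatedly and [sq f] dominates the sum over [k] of [sq] of the [k]-th layers
([sq_layer_sum]).  These are tuples of indicators: their images under [sq] are
measurable, so that the integral of the sum is the sum of the integrals, and
each integral is bounded below by hypothesis.

What remains is to choose the levels so that the sum of the means of the layer
norms is close to the mean of the norms of the [f i].  As the mean is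
homogeneous and monotone ([wmean_homogeneous_le]), it suffices that, for every
[i] simultaneously, each of the [M] layers of [f i] has norm at least
[c / M] times that of [f i], with [c < 1] arbitrary; the sum is then at least
[c] times the mean.  Such levels exist ([equal_norm_levels]) because, by
Minkowski's inequality, the Lorentz integral of
[phi r = || \1_(f >= r) ||_p] over [r > 0] is at least [|| f ||_p]: a lower
Riemann sum of it on a fine uniform grid exceeds [c || f ||_p]
([Lnorm_layer_sum_gt] and [Lnorm_layer_sum]), and the area under a
non-increasing function can be cut by greedy vertical slicing into [M]
rectangles of equal area, losing at most one rectangle per grid cell, a loss
that is negligible for large [M] ([equal_area_levels]).  Taking [M] large
enough for all [i] gives a common number of layers. *)

(** * The weighted mean *)

Section weighted_mean.
Context (R : realType).

Lemma powR_powRV (r x : R) : r != 0 -> 0 < x -> (x `^ r) `^ r^-1 = x.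
Proof. by move=> r0 x0; rewrite -powRrM mulfV// powRr1// ltW. Qed.

Lemma lt0_ger_powR (r x y : R) : r < 0 -> 0 < x -> x <= y ->
  y `^ r <= x `^ r.
Proof.
move=> r0 x0 xy; have y0 := lt_le_trans x0 xy.
rewrite -lef_pV2 ?posrE ?powR_gt0// -!powRN.
by apply: ge0_ler_powR; rewrite ?nnegrE ?oppr_ge0; [exact: ltW..|].
Qed.

Lemma wmean_ge0 n (t : 'I_n -> R) al u :
  (al < +oo)%E -> (forall i, 0 <= u i) -> 0 <= wmean t al u.
Proof.
move=> aly u0; rewrite /wmean; case: ifPn => // _.
case: al aly => [r _|//|_].
- by case: ifPn => _; [apply: prodr_ge0 => i _|]; exact: powR_ge0.
- have [->|/set0P u_neq0] := eqVneq (range u) set0; first by rewrite inf0.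
  by apply: lb_le_inf => // _ [i _ <-].
Qed.

Lemma wmean_eq0 n (t : 'I_n -> R) al u i : u i = 0 -> wmean t al u = 0.
Proof.
by move=> ui0; rewrite /wmean ifT//; apply/existsP; exists i; rewrite ui0.
Qed.

(** Homogeneity and monotonicity in one inequality.  Positivity of [u] makes
negative powers order-reversing; a zero entry makes the mean vanish outright. *)
Lemma wmean_homogeneous_le n (t : 'I_n -> R) (al : \bar R) (c : R)
    (u v : 'I_n -> R) :
  (al < +oo)%E -> (forall i, 0 < t i) -> \sum_(i < n) t i = 1 ->
  0 < c -> (forall i, 0 < u i) -> (forall i, c * u i <= v i) ->
  c * wmean t al u <= wmean t al v.
Proof.
move=> aly t0 t1 c0 u0 cuv.
have cu0 i : 0 < c * u i by rewrite mulr_gt0.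
have v0 i : 0 < v i by rewrite (lt_le_trans (cu0 i)).
have nz (w : 'I_n -> R) : (forall i, 0 < w i) -> [exists i, w i == 0] = false.
  by move=> w0; apply/existsP => -[i]; rewrite gt_eqF.
rewrite /wmean !nz//; case: al aly => [r _|//|_].
- case: eqVneq => [_|r0].
    (* The geometric mean is homogeneous because the weights sum to one. *)
    have -> : c = \prod_(i < n) c `^ t i.
      rewrite -[LHS](powRr1 (ltW c0)) -[X in _ `^ X]t1.
      apply: (big_morph (powR c)) => [x y|]; last exact: powRr0.
      by rewrite powRD// (gt_eqF c0) /= implybT.
    rewrite -big_split/=; apply: ler_prod => i _.
    rewrite mulr_ge0 ?powR_ge0//= -powRM; [|exact: ltW..].
    by apply: ge0_ler_powR => //; rewrite ?nnegrE ltW//.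
  rewrite -{1}(powR_powRV r0 c0) -powRM ?powR_ge0//; last first.
    by apply: sumr_ge0 => i _; rewrite mulr_ge0 ?powR_ge0// ltW.
  rewrite mulr_sumr.
  under eq_bigr do rewrite mulrCA -powRM ?(ltW c0) ?(ltW (u0 _))//.
  have n0 : (0 < n)%N.
    by case: (n) t t1 {t0 u v u0 cuv cu0 v0 nz} => // t /esym/eqP;
      rewrite big_ord0 oner_eq0.
  have sum0 (w : 'I_n -> R) : (forall i, 0 < w i) ->
      0 < \sum_(i < n) t i * w i `^ r.
    move=> w0; rewrite (bigD1 (Ordinal n0))//= ltr_pwDl//.
      by rewrite mulr_gt0// powR_gt0.
    by apply: sumr_ge0 => i _; rewrite mulr_ge0 ?powR_ge0// ltW.
  have /orP[rlt|rgt] : (r < 0) || (0 < r) by rewrite -neq_lt.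
    apply: lt0_ger_powR; [by rewrite invr_lt0|exact: sum0|].
    apply: ler_sum => i _; rewrite ler_pM2l//; exact: lt0_ger_powR.
  apply: ge0_ler_powR; rewrite ?nnegrE ?invr_ge0;
    [exact: ltW|exact/ltW/sum0|exact/ltW/sum0|].
  apply: ler_sum => i _; rewrite ler_pM2l//.
  by apply: ge0_ler_powR => //; rewrite ?nnegrE ?ltW.
- have i0 : 'I_n.
    by case: (n) t t1 {t0 u v u0 cuv cu0 v0 nz} => [t /esym/eqP|*];
      [rewrite big_ord0 oner_eq0|exact: ord0].
  apply: lb_le_inf; first by exists (v i0), i0.
  move=> _ [i _ <-]; apply: le_trans (cuv i); rewrite ler_pM2l//.
  apply: ge_inf; last by exists i.
  by exists 0 => _ [j _ <-]; exact: ltW.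
Qed.

End weighted_mean.

(** * Slicing the area under a non-increasing function *)

Section equal_area.
Context (R : realType) (phi : R -> R).
Hypothesis phi_ge0 : forall x, 0 <= phi x.
Hypothesis phi_anti : forall x y, 0 < x -> x <= y -> phi y <= phi x.

(** The rectangle over the interval from [x] to [y], of height [phi y], lies
under the graph of the non-increasing [phi]. *)
Definition area_step (dlt x y : R) := (x < y) && (dlt <= (y - x) * phi y).

(** The width [dlt / phi r] always suffices before [r], since [phi] is at least
[phi r] there; each such step uses up exactly [dlt] of the area of the
rectangle below height [phi r] that is still available. *)
Lemma greedy_steps dlt r k x : 0 < dlt -> 0 <= x -> x <= r ->
  k%:R * dlt <= (r - x) * phi r ->
  exists l, [/\ size l = k, path (area_step dlt) x l & last x l <= r].
Proof.
move=> d0; elim: k x => [|k IH] x x0 xr kd; first by exists [::].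
have p0 : 0 < phi r.
  rewrite lt_neqAle phi_ge0 andbT; apply/eqP => p0.
  by move: kd; rewrite -p0 mulr0 leNgt mulr_gt0// ltr0n.
have dp0 : 0 < dlt / phi r by rewrite divr_gt0.
have kd0 : 0 <= k%:R * dlt by rewrite mulr_ge0// ltW.
have yr : x + dlt / phi r <= r.
  rewrite -lerBrDl ler_pdivrMr//; apply: le_trans kd.
  by rewrite -natr1 mulrDl mul1r lerDr.
have [|//||l [sl pl ll]] := IH (x + dlt / phi r).
- by rewrite addr_ge0// ltW.
- by rewrite opprD addrA mulrBl divfK ?gt_eqF// lerBrDr (le_trans _ kd)//
    -natr1 mulrDl mul1r.
exists (x + dlt / phi r :: l); split => //=; first by rewrite sl.
rewrite pl andbT /area_step ltrDl dp0/= addrAC subrr add0r.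
rewrite -[leLHS](@divfK _ (phi r)) ?gt_eqF// ler_pM2l//.
by apply: phi_anti => //; rewrite ltr_wpDl.
Qed.

(** Greedy slicing in each cell of the grid in turn wastes less than one slice
of area [dlt] per cell.  A cell may be entered from before its left end, which
only enlarges the available rectangle. *)
Lemma grid_steps dlt h M : 0 < dlt -> 0 < h ->
  exists l, [/\ path (area_step dlt) 0 l, last 0 l <= M%:R * h &
    \sum_(k < M) h * phi (k.+1%:R * h) <= (size l + M)%:R * dlt].
Proof.
move=> d0 h0; elim: M => [|M [l [pl ll sl]]].
  by exists [::]; rewrite /= big_ord0 !mul0r.
have l0 : 0 <= last 0 l.
  have : path <=%R 0 l by apply: sub_path pl => x y /andP[/ltW].
  by rewrite le_path_sortedE => /andP[/allP]; case: (lastP l) => // s x;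
    rewrite last_rcons => + _; apply; rewrite mem_rcons inE eqxx.
set r := M.+1%:R * h.
have hr : h <= r - last 0 l.
  by rewrite lerBrDr -lerBrDl (le_trans ll)// /r -natr1 mulrDl mul1r addrK.
set a := (r - last 0 l) * phi r.
have a0 : 0 <= a / dlt.
  by rewrite divr_ge0 ?(ltW d0)// mulr_ge0 ?phi_ge0// (le_trans _ hr)// ltW.
have [ta at1] := andP (truncn_itv a0).
have [|//|||l' [sl' pl' ll']] :=
  @greedy_steps dlt r (Num.truncn (a / dlt)) (last 0 l).
- exact: d0.
- by rewrite -subr_ge0 (le_trans _ hr)// ltW.
- by rewrite -ler_pdivlMr.
exists (l ++ l'); rewrite cat_path pl pl' last_cat ll'; split => //.
rewrite big_ord_recr/= size_cat sl'.
have -> : ((size l + Num.truncn (a / dlt) + M.+1) =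
  (size l + M) + (Num.truncn (a / dlt)).+1)%N by rewrite addnS addnAC addnS.
rewrite natrD mulrDl lerD//.
apply: (@le_trans _ _ a); first by rewrite /a ler_wpM2r.
by rewrite -ler_pdivrMr// ltW.
Qed.

(** With slices of area [tht / N], the waste of [M] slices is at most
[M * tht / N], which falls below the surplus [S - tht] of the Riemann sum [S]
once [N] is large; so at least [N] slices are found. *)
Lemma equal_area_levels tht h M : 0 < tht -> 0 < h ->
  tht < \sum_(k < M) h * phi (k.+1%:R * h) ->
  exists N0, forall N, (N0 <= N)%N -> (0 < N)%N ->
    exists s : nat -> R, s 0%N = 0 /\ forall k, (k < N)%N ->
      s k < s k.+1 /\ tht / N%:R <= (s k.+1 - s k) * phi (s k.+1).
Proof.
move=> t0 h0; set S := \sum_(k < M) _ => tS.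
exists (Num.truncn (M%:R * tht / (S - tht))).+1 => N NN N0.
have NR0 : 0 < N%:R :> R by rewrite ltr0n.
have [|//|l [pl _ Sl]] := @grid_steps (tht / N%:R) h M.
  by rewrite divr_gt0.
have Nl : (N <= size l)%N.
  rewrite -(ler_nat R).
  have : M%:R * tht / (S - tht) < N%:R.
    by rewrite (lt_le_trans (truncnS_gt _))// ler_nat.
  rewrite ltr_pdivrMr ?subr_gt0// => H1.
  have : N%:R * S <= (size l + M)%:R * tht.
    by rewrite mulrC -ler_pdivlMr// -mulrA.
  rewrite natrD mulrDl => H2.
  by rewrite -(ler_pM2r t0); nra.
exists (nth 0 (0 :: l)); split => // k kN.
by have /andP[] := pathP 0 pl k (leq_trans kN Nl).
Qed.

End equal_area.

(** * Layer decompositions *)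

Section layers.
Context (R : realType) (T : Type).
Implicit Types (s : nat -> R) (f : T -> R).

Definition layer_sum s f (K : nat) (x : T) : R :=
  \sum_(k < K) (s k.+1 - s k) * \1_[set y | s k.+1 <= f y] x.

Lemma layer_sumS s f K x : layer_sum s f K.+1 x =
  layer_sum s f K x + (s K.+1 - s K) * \1_[set y | s K.+1 <= f y] x.
Proof. by rewrite /layer_sum big_ord_recr. Qed.

Lemma indic_superlevel f (r : R) x :
  \1_[set y | r <= f y] x = (r <= f x)%R%:R :> R.
Proof.
rewrite indicE; congr (nat_of_bool _)%:R.
by apply/idP/idP; rewrite inE.
Qed.

Lemma levels_ge0 s K : s 0%N = 0 -> (forall k, (k < K)%N -> s k < s k.+1) ->
  0 <= s K.
Proof.
move=> s0; elim: K => [|K IH] sI; first by rewrite s0.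
rewrite (le_trans (IH _)) ?ltW ?sI// => k kK; exact/sI/leqW.
Qed.

Section increasing_levels.
Variables (s : nat -> R) (f : T -> R).
Hypothesis s0 : s 0%N = 0.
Hypothesis f0 : forall x, 0 <= f x.

Lemma layer_sum_full K x : (forall k, (k < K)%N -> s k < s k.+1) ->
  s K <= f x -> layer_sum s f K x = s K.
Proof.
elim: K => [|K IH] sI sf; first by rewrite /layer_sum big_ord0.
have {}IH : layer_sum s f K x = s K.
  apply: IH => [k kK|]; first exact/sI/leqW.
  exact: le_trans (ltW (sI _ _)) sf.
by rewrite layer_sumS IH indic_superlevel sf mulr1 addrC subrK.
Qed.

Lemma layer_sum_ge0 K x : (forall k, (k < K)%N -> s k < s k.+1) ->
  0 <= layer_sum s f K x.
Proof.
move=> sI; apply: sumr_ge0 => k _; rewrite indic_superlevel mulr_ge0//.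
by rewrite subr_ge0 ltW// sI.
Qed.

Lemma layer_sum_le K x : (forall k, (k < K)%N -> s k < s k.+1) ->
  layer_sum s f K x <= f x.
Proof.
elim: K => [|K IH] sI; first by rewrite /layer_sum big_ord0.
have [sf|sf] := leP (s K.+1) (f x); first by rewrite layer_sum_full.
rewrite layer_sumS indic_superlevel (lt_geF sf)/= mulr0 addr0.
by apply: IH => k kK; exact/sI/leqW.
Qed.

Lemma layer_sum_le_level K x : (forall k, (k < K)%N -> s k < s k.+1) ->
  layer_sum s f K x <= s K.
Proof.
elim: K => [|K IH] sI; first by rewrite /layer_sum big_ord0 s0.
have {}IH : layer_sum s f K x <= s K by apply: IH => k kK; exact/sI/leqW.
rewrite layer_sumS indic_superlevel; case: (s K.+1 <= f x) => /=.
  by rewrite mulr1 -lerBrDr opprB addrC subrK.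
by rewrite mulr0 addr0 (le_trans IH)// ltW// sI.
Qed.

Lemma layer_sum_approx h K x : (forall k, (k < K)%N -> s k < s k.+1) ->
  (forall k, (k < K)%N -> s k.+1 <= s k + h) ->
  f x < s K -> f x <= layer_sum s f K x + h.
Proof.
elim: K => [|K IH] sI sh fs; first by move: fs; rewrite s0 ltNge f0.
have sI' k : (k < K)%N -> s k < s k.+1 by move=> ?; exact/sI/leqW.
rewrite layer_sumS indic_superlevel (lt_geF fs)/= mulr0 addr0.
have [sf|fs'] := leP (s K) (f x).
  by rewrite layer_sum_full// (le_trans (ltW fs))// sh.
by apply: IH => // k kK; exact/sh/leqW.
Qed.

(** A layer sum takes only the values [s k], and exceeds [s k] exactly where [f]
reaches [s k.+1]; so its non-empty superlevel sets are among those
of [f]. *)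
Lemma superlevel_layer_sum K (r : R) : (forall k, (k < K)%N -> s k < s k.+1) ->
  0 < r -> [set x | r <= layer_sum s f K x] = set0 \/
  exists2 k, (k < K)%N &
    [set x | r <= layer_sum s f K x] = [set x | s k.+1 <= f x].
Proof.
move=> + r0; elim: K => [|K IH] sI.
  by left; apply/seteqP; split=> // x /=; rewrite /layer_sum big_ord0 leNgt r0.
have sI' k : (k < K)%N -> s k < s k.+1 by move=> ?; exact/sI/leqW.
have [rK|Kr] := leP r (s K).
  have -> : [set x | r <= layer_sum s f K.+1 x] =
      [set x | r <= layer_sum s f K x].
    apply/funext => x /=; rewrite layer_sumS indic_superlevel.
    have [sf|_] := leP (s K.+1) (f x); last by rewrite mulr0 addr0.
    rewrite layer_sum_full//; last exact: le_trans (ltW (sI _ _)) sf.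
    by rewrite mulr1 addrC subrK rK (le_trans rK)// ltW// sI.
  by have [->|[k kK ->]] := IH sI'; [left|right; exists k => //; exact: leqW].
have [rK1|K1r] := leP r (s K.+1); last first.
  left; apply/seteqP; split=> // x /=.
  by apply/negP; rewrite -ltNge (le_lt_trans (layer_sum_le_level _ _)).
right; exists K => //; apply/seteqP; split => x /=; last first.
  by move=> sf; rewrite layer_sum_full.
rewrite layer_sumS indic_superlevel; have [//|_] := leP (s K.+1) (f x).
rewrite mulr0 addr0 => /(lt_le_trans Kr).
by rewrite ltNge layer_sum_le_level.
Qed.

(** The form in which layers meet the condition for superadditivity: below the
next level, the accumulated layers are saturated where [f] is large. *)
Lemma layer_sum_top K x y : (forall k, (k < K)%N -> s k < s k.+1) ->
  s K <= f x -> layer_sum s f K y <= layer_sum s f K x.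
Proof. by move=> sI sf; rewrite [leRHS]layer_sum_full// layer_sum_le_level. Qed.

End increasing_levels.
End layers.

(** * Norms of layers *)

Section Lnorm_layers.
Context d (T : measurableType d) (R : realType) (mu : {measure set T -> \bar R}).
Variable p : R.
Hypothesis p1 : 1 <= p.

Let p0 : 0 < p. Proof. exact: lt_le_trans p1. Qed.

Let N (f : T -> R) := ('N[mu]_(p%:E)[EFin \o f])%E.

Lemma measurable_normr_powR (f : T -> R) : measurable_fun setT f ->
  measurable_fun setT (fun x => (`|f x| `^ p)%:E).
Proof.
move=> mf; apply/measurable_EFinP.
apply: (@measurableT_comp _ _ _ _ _ _ (@powR R ^~ p)) => //.
exact: measurableT_comp.
Qed.

Lemma Lnorm_EFin (f : T -> R) : 'N[mu]_(p%:E)[EFin \o f]%E =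
  ((\int[mu]_x (`|f x| `^ p)%:E) `^ p^-1)%E.
Proof. by rewrite unlock. Qed.

Lemma le_Lnorm (f g : T -> R) : measurable_fun setT f -> measurable_fun setT g ->
  (forall x, 0 <= f x <= g x) -> (N f <= N g)%E.
Proof.
move=> mf mg fg; rewrite /N !Lnorm_EFin.
apply: gt0_ler_poweR; rewrite ?invr_ge0 ?(ltW p0)//.
- by rewrite in_itv/= integral_ge0 ?leey// => x _; rewrite lee_fin powR_ge0.
- by rewrite in_itv/= integral_ge0 ?leey// => x _; rewrite lee_fin powR_ge0.
apply: ge0_le_integral => //; try exact: measurable_normr_powR.
move=> x _; have /andP[f0 fgx] := fg x.
rewrite lee_fin ge0_ler_powR ?nnegrE ?(ltW p0)//.
by rewrite !ger0_norm// (le_trans f0).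
Qed.

Lemma LnormZ_ge0 (a : R) (f : T -> R) : 0 <= a -> measurable_fun setT f ->
  (N (fun x => (a * f x)%R) = a%:E * N f)%E.
Proof.
move=> a0 mf; rewrite /N !Lnorm_EFin.
under eq_integral do rewrite normrM (ger0_norm a0) powRM// EFinM.
rewrite ge0_integralZl_EFin ?powR_ge0//; last exact: measurable_normr_powR.
rewrite poweRM ?lee_fin ?powR_ge0//; last first.
  by apply: integral_ge0 => x _; rewrite lee_fin powR_ge0.
by rewrite poweR_EFin -powRrM mulfV ?powRr1// gt_eqF.
Qed.

Lemma measurable_superlevel (f : T -> R) r : measurable_fun setT f ->
  measurable [set x | r <= f x].
Proof.
move=> mf; rewrite (_ : [set _ | _] = setT `&` f @^-1` `[r, +oo[).
  exact: mf.
by rewrite setTI; apply/seteqP; split => x /=; rewrite in_itv/= andbT.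
Qed.

Lemma measurable_layer_sum s (f : T -> R) K : measurable_fun setT f ->
  measurable_fun setT (layer_sum s f K).
Proof.
move=> mf; apply: measurable_sum => k; apply: measurable_funM => //.
exact/measurable_indic/measurable_superlevel.
Qed.

(** Minkowski's inequality; the right-hand side is a lower Riemann sum of the
Lorentz integral of [f]. *)
Lemma Lnorm_layer_sum s (f : T -> R) K : measurable_fun setT f ->
  (forall k, (k < K)%N -> s k < s k.+1) ->
  (N (layer_sum s f K) <=
   \sum_(k < K) (s k.+1 - s k)%:E * N (\1_[set x | s k.+1 <= f x])%R)%E.
Proof.
move=> mf; have ms r := measurable_superlevel r mf.
have mG j := measurable_layer_sum s j mf.
elim: K => [|K IH] sI.
  rewrite big_ord0 (_ : layer_sum s f 0 = cst 0); last first.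
    by apply/funext => x; rewrite /layer_sum big_ord0.
  by rewrite /N (_ : EFin \o cst 0 = cst 0%E)// Lnorm0// eqe gt_eqF.
rewrite big_ord_recr/=.
rewrite (_ : layer_sum s f K.+1 = layer_sum s f K \+
    (fun x => (s K.+1 - s K) * \1_[set y | s K.+1 <= f y] x)); last first.
  by apply/funext => x; rewrite layer_sumS.
apply: (le_trans (minkowski_EFin mu (mG K) _ p1)).
  exact: measurable_funM.
apply: leeD; first by apply: IH => k kK; exact/sI/leqW.
by rewrite -LnormZ_ge0// subr_ge0 ltW// sI.
Qed.

Section approximation.
Variable f : T -> R.
Hypotheses (f0 : forall x, 0 <= f x) (mf : measurable_fun setT f).
Hypothesis Nf : (N f < +oo)%E.

Definition uniform_level n (k : nat) : R := k%:R / n.+1%:R.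

(* The range of the levels, n.+1, grows while the mesh, n.+1^-1, shrinks. *)
Let G n := layer_sum (uniform_level n) f (n.+1 * n.+1).

Lemma uniform_level0 n : uniform_level n 0 = 0.
Proof. by rewrite /uniform_level mul0r. Qed.

Lemma uniform_levelS n k : uniform_level n k.+1 = uniform_level n k + n.+1%:R^-1.
Proof. by rewrite /uniform_level -natr1 mulrDl mul1r. Qed.

Lemma uniform_level_lt n k : uniform_level n k < uniform_level n k.+1.
Proof. by rewrite uniform_levelS ltrDl invr_gt0. Qed.

Lemma cvg_layer_sum x : G n x @[n --> \oo] --> f x.
Proof.
apply: (@squeeze_cvgr _ _ _ _ (fun n => f x - n.+1%:R^-1) (fun=> f x)).
- exists (Num.truncn (f x)) => // n /= xn; rewrite /G.
  rewrite layer_sum_le ?uniform_level0 ?andbT//; last first.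
    by move=> ? _; exact: uniform_level_lt.
  rewrite lerBlDr layer_sum_approx ?uniform_level0//.
  + by move=> ? _; exact: uniform_level_lt.
  + by move=> k _; rewrite uniform_levelS.
  + rewrite /uniform_level natrM mulfK//.
    by rewrite (lt_le_trans (truncnS_gt _))// ler_nat.
- rewrite -[X in _ --> X]subr0; apply: cvgB; first exact: cvg_cst.
  exact: cvg_harmonic.
- exact: cvg_cst.
Qed.

(** Dominated convergence, with [f ^ p] as the dominating function. *)
Lemma Lnorm_layer_sum_gt (tht : R) : 0 <= tht -> (tht%:E < N f)%E ->
  exists n, (tht%:E < N (G n))%E.
Proof.
move=> t0 tN; apply: contrapT => /forallNP GN.
have {}GN n : (N (G n) <= tht%:E)%E by rewrite leNgt; exact/negP.
have mG n : measurable_fun setT (G n) by exact: measurable_layer_sum.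
have G0 n x : 0 <= G n x.
  by apply: layer_sum_ge0 => ? _; exact: uniform_level_lt.
have Gf n x : G n x <= f x.
  by apply: layer_sum_le => [|//|? _]; [exact: uniform_level0|
    exact: uniform_level_lt].
have NE g : (\int[mu]_x (`|g x| `^ p)%:E = N g `^ p)%E.
  by rewrite poweR_Lnorm ?gt_eqF.
have int_f : mu.-integrable setT (fun x => (`|f x| `^ p)%:E).
  apply/integrableP; split; first exact: measurable_normr_powR.
  under eq_integral do rewrite gee0_abs ?lee_fin ?powR_ge0//.
  by rewrite NE poweR_lty.
have cvgGp x : (`|G n x| `^ p) @[n --> \oo] --> `|f x| `^ p.
  under eq_fun do rewrite ger0_norm//.
  rewrite (ger0_norm (f0 x)).
  have [fx0|fx0] := eqVneq (f x) 0.
    under eq_fun => n.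
      have -> : G n x = f x by apply/eqP; rewrite eq_le Gf fx0 G0.
      over.
    exact: cvg_cst.
  apply: (@continuous_cvg _ _ _ _ _ (G ^~ x) (@powR R ^~ p)).
    apply: differentiable_continuous; apply/derivable1_diffP/derivable_powR.
    by rewrite in_itv/= andbT lt_neqAle eq_sym fx0 f0.
  exact: cvg_layer_sum.
have [] := @dominated_convergence _ _ _ mu setT measurableT
  (fun n x => (`|G n x| `^ p)%:E) (fun x => (`|f x| `^ p)%:E)
  (fun x => (`|f x| `^ p)%:E).
- by move=> n; exact: measurable_normr_powR.
- exact: measurable_normr_powR.
- apply/nearW => x _; apply: cvg_EFin; first exact: nearW.
  exact: cvgGp.
- exact: int_f.
- apply/nearW => x n _; rewrite lee_fin ger0_norm ?powR_ge0//.
  by rewrite ge0_ler_powR ?nnegrE ?(ltW p0)// !ger0_norm.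
move=> _ _ /= cvgI; suff : (N f <= tht%:E)%E by rewrite leNgt tN.
have Np : (N f `^ p <= tht%:E `^ p)%E.
  rewrite -NE -(cvg_lim _ cvgI)//; apply: lime_le; first exact: cvgP cvgI.
  apply/nearW => n; rewrite NE; apply: gt0_ler_poweR; rewrite ?(ltW p0)//.
  - by rewrite in_itv/= leey Lnorm_ge0.
  - by rewrite in_itv/= leey lee_fin t0.
have NN g : (0 <= g)%E -> ((g `^ p) `^ p^-1)%E = g.
  by move=> ?; rewrite -poweRrM mulfV ?gt_eqF// poweRe1.
rewrite -(NN (N f)) ?Lnorm_ge0// -(NN tht%:E) ?lee_fin//.
apply: gt0_ler_poweR => //; rewrite ?invr_ge0 ?(ltW p0)//.
- by rewrite in_itv/= leey ?poweR_ge0 ?lee_fin ?powR_ge0.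
- by rewrite in_itv/= leey ?poweR_ge0 ?lee_fin ?powR_ge0.
Qed.

(** Chebyshev's inequality: [r * \1_(f >= r)] is at most [f]. *)
Lemma Lnorm_superlevel_lty (r : R) : 0 < r ->
  (N (\1_[set x | r <= f x])%R < +oo)%E.
Proof.
move=> r0; have : (r%:E * N (\1_[set x | r <= f x])%R < +oo)%E.
  rewrite -LnormZ_ge0 ?(ltW r0)//; last first.
    exact/measurable_indic/measurable_superlevel/mf.
  apply: le_lt_trans Nf; apply: le_Lnorm => //.
    apply: measurable_funM => //.
    exact/measurable_indic/measurable_superlevel/mf.
  move=> x; rewrite indic_superlevel mulr_ge0 ?(ltW r0)//=.
  by have [rf|_] := leP r (f x); rewrite ?mulr1 ?mulr0.
rewrite !ltNge !leye_eq; apply: contra => /eqP ->.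
by rewrite gt0_muley ?lte_fin.
Qed.

(** The number of layers [M] is free above a threshold, so that several
functions can be cut into the same number of layers. *)
Lemma equal_norm_levels (tht : R) : 0 < tht -> (tht%:E < N f)%E ->
  exists N0, forall M, (N0 <= M)%N -> (0 < M)%N ->
    exists s : nat -> R, s 0%N = 0 /\ forall k, (k < M)%N ->
      s k < s k.+1 /\
      ((tht / M%:R)%:E <= N (fun x => (s k.+1 - s k) *
                                \1_[set y | s k.+1 <= f y] x)%R)%E.
Proof.
move=> t0 tN; pose phi r : R := fine (N \1_[set x | r <= f x]).
have phiE r : 0 < r -> N \1_[set x | r <= f x] = (phi r)%:E.
  move=> r0; rewrite fineK// ge0_fin_numE ?Lnorm_ge0//.
  exact: Lnorm_superlevel_lty.
have phi_ge0 r : 0 <= phi r by rewrite fine_ge0// Lnorm_ge0.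
have mI r : measurable_fun setT (\1_[set x | r <= f x] : T -> R).
  exact/measurable_indic/measurable_superlevel/mf.
have phi_anti r r' : 0 < r -> r <= r' -> phi r' <= phi r.
  move=> r0 rr'; rewrite -lee_fin -!phiE ?(lt_le_trans r0)//.
  apply: le_Lnorm => // x; rewrite !indic_superlevel ler0n ler_nat/=.
  by have [/(le_trans rr') ->|] := leP r' (f x).
have [n] := Lnorm_layer_sum_gt (ltW t0) tN.
have := @Lnorm_layer_sum (uniform_level n) f (n.+1 * n.+1) mf.
move=> /(_ (fun k _ => uniform_level_lt n k)) /[swap].
move=> /lt_le_trans/[apply].
rewrite (eq_bigr (fun k : 'I__ =>
  (n.+1%:R^-1 * phi (k.+1%:R * n.+1%:R^-1))%:E)); last first.
  move=> k _; rewrite EFinM -phiE ?mulr_gt0// ?invr_gt0//.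
  by congr (_%:E * _)%E; rewrite uniform_levelS addrAC subrr add0r.
rewrite sumEFin lte_fin => tS.
have [||N0 HN0] := @equal_area_levels R phi phi_ge0 phi_anti tht n.+1%:R^-1
  (n.+1 * n.+1) t0.
- by rewrite invr_gt0.
- exact: tS.
exists N0 => M NM M0; have [s [s0 Hs]] := HN0 M NM M0.
exists s; split => // k kM; have [sk ts] := Hs k kM; split => //.
have sk0 : 0 <= s k.
  by apply: levels_ge0 s0 _ => j jk; have [] := Hs j (ltn_trans jk kM).
rewrite LnormZ_ge0 ?subr_ge0 ?(ltW sk)//.
by rewrite phiE ?(le_lt_trans sk0)// -EFinM lee_fin.
Qed.

End approximation.
End Lnorm_layers.

(** * The lower integral *)

Section lower_integral.
Context d (T : measurableType d) (R : realType) (nu : {measure set T -> \bar R}).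
Import HBNNSimple.

(** The integral of a non-negative function is itself defined as a supremum over
the simple functions below it. *)
Lemma lower_integralE (phi : T -> \bar R) : (forall x, 0 <= phi x)%E ->
  lower_integral nu phi = (\int[nu]_x phi x)%E.
Proof.
move=> phi0; rewrite ge0_integralTE//; congr ereal_sup.
by apply/seteqP; split => _ [s ? <-]; exists s; rewrite ?integralT_nnsfun.
Qed.

Lemma le_lower_integral (phi psi : T -> \bar R) : (forall x, phi x <= psi x)%E ->
  (lower_integral nu phi <= lower_integral nu psi)%E.
Proof.
move=> le; apply: le_ereal_sup => _ [s sphi <-]; exists s => // x.
exact: le_trans (sphi x) (le x).
Qed.

End lower_integral.

(** * Generalized sup-convolutions of layers *)

Lemma superlevel_in_indic (R : realType) (T : Type) (A : set (set T)) (a : R)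
    (X : set T) : A set0 -> 0 <= a -> A X ->
  superlevel_in A (fun x => a * \1_X x).
Proof.
move=> A0 a0 AX; split=> [x|s s0].
  by rewrite indicE; case: (x \in X); rewrite ?mulr1 ?mulr0.
have [sa|as_] := leP s a.
  suff -> : [set x | s <= a * \1_X x] = X by [].
  apply/seteqP; split => x /=; rewrite indicE.
    by have [/set_mem//|_] := boolP (x \in X); rewrite mulr0 leNgt s0.
  by move=> /mem_set ->; rewrite mulr1.
suff -> : [set x | s <= a * \1_X x] = set0 by [].
apply/seteqP; split => // x /=; rewrite indicE leNgt => /negP; apply.
by case: (x \in X); rewrite ?mulr1 ?mulr0.
Qed.

Lemma superlevel_in_layer_sum (R : realType) (T : Type) (A : set (set T))
    (s : nat -> R) (f : T -> R) K : A set0 -> superlevel_in A f ->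
  s 0%N = 0 -> (forall k, (k < K)%N -> s k < s k.+1) ->
  superlevel_in A (layer_sum s f K).
Proof.
move=> A0 [f0 Af] s0 sI; split=> [x|r r0]; first exact: layer_sum_ge0.
have [->//|[k kK ->]] := superlevel_layer_sum f s0 sI r0.
apply: Af; rewrite (le_lt_trans _ (sI k kK))//.
by apply: levels_ge0 s0 _ => j jk; exact/sI/(ltn_trans jk).
Qed.

(** Superadditivity adds the layers one at a time from the bottom: the next
layer lives where [f i] reaches [s i K.+1], hence where the first [K] layers are
maximal. *)
Lemma sq_layer_sum (R : realType) (n : nat)
    (dE : 'I_n -> measure_display) (E : forall i, measurableType (dE i))
    (dF : measure_display) (F : measurableType dF)
    (A : forall i, set (set (E i)))
    (sq : (forall i, E i -> R) -> F -> \bar R)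
    (f : forall i, E i -> R) (s : 'I_n -> nat -> R) K :
  (forall i, A i set0) -> gen_sup_convolution A sq ->
  (forall i, superlevel_in (A i) (f i)) ->
  (forall i, s i 0%N = 0) ->
  (forall i k, (k < K)%N -> s i k < s i k.+1) -> forall z,
  (\sum_(k < K) sq (indic_tuple (fun i => (s i k.+1 - s i k)%R)
     (fun i => [set x | (s i k.+1 <= f i x)%R])) z <=
   sq (fun i => layer_sum (s i) (f i) K) z)%E.
Proof.
move=> A_set0 sq_gsc Af s0; elim: K => [|K IH] sI z.
  rewrite big_ord0; apply: (gsc_ge0 sq_gsc) => i.
  exact: superlevel_in_layer_sum.
have sI' i k : (k < K)%N -> s i k < s i k.+1 by move=> ?; exact/sI/leqW.
rewrite big_ord_recr/=; apply: le_trans (leeD (IH sI' z) (lexx _)) _.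
have -> : (fun i => layer_sum (s i) (f i) K.+1) = (fun i x =>
    layer_sum (s i) (f i) K x + indic_tuple (fun i => s i K.+1 - s i K)
      (fun i => [set x | s i K.+1 <= f i x]) i x).
  apply/functional_extensionality_dep => i; apply/funext => x.
  exact: layer_sumS.
apply: (gsc_superadd sq_gsc) => i.
- by apply: superlevel_in_layer_sum => // k; exact: sI'.
- apply: superlevel_in_indic => //; first by rewrite subr_ge0 ltW// sI.
  apply: (Af i).2; rewrite (le_lt_trans _ (sI i K _))//.
  exact: levels_ge0 (s0 i) (sI' i).
- move=> x; rewrite /indic_tuple indic_superlevel => + y.
  have [sf _|_] := leP (s i K.+1) (f i x); last by rewrite mulr0 ltxx.
  apply: layer_sum_top => // [k|]; first exact: sI'.
  exact: le_trans (ltW (sI _ _ _)) sf.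
Qed.

Theorem theorem2p4 (R : realType) (n : nat)
    (dE : 'I_n -> measure_display) (E : forall i, topMeasurableType (dE i))
    (mu : forall i, {measure set (E i) -> \bar R})
    (dF : measure_display) (F : topMeasurableType dF)
    (nu : {measure set F -> \bar R})
    (polE : forall i, polish_measurable R (E i))
    (polF : polish_measurable R F)
    (A : forall i, set (set (E i)))
    (A_meas : forall i X, A i X -> measurable X)
    (A_analytic : forall i X, A i X -> analytic R X)
    (A_set0 : forall i, A i set0)
    (alpha : \bar R) (alpha_le1 : (alpha <= 1)%E)
    (t : 'I_n -> R) (t_gt0 : forall i, 0 < t i) (t_sum1 : \sum_(i < n) t i = 1)
    (p : 'I_n -> R) (p_ge1 : forall i, 1 <= p i)
    (sq : (forall i, E i -> R) -> F -> \bar R)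
    (sq_gsc : gen_sup_convolution A sq) :
  (forall (a : 'I_n -> R) (X : forall i, set (E i)),
     (forall i, 0 < a i) -> (forall i, A i (X i)) ->
     (* the mean is only defined at finite norms *)
     (forall i,
        ('N[mu i]_((p i)%:E)[EFin \o indic_tuple a X i] < +oo)%E) ->
     ((wmean t alpha (fun i =>
         fine 'N[mu i]_((p i)%:E)[EFin \o indic_tuple a X i]))%:E
      <= \int[nu]_z sq (indic_tuple a X) z)%E)
  <->
  (forall f : forall i, E i -> R,
     (forall i, superlevel_in (A i) (f i)) ->
     (forall i, f i \in Lfun (mu i) (p i)%:E) ->
     ((wmean t alpha (fun i =>
         fine 'N[mu i]_((p i)%:E)[EFin \o f i]))%:E
      <= lower_integral nu (sq f))%E).
Proof.
have alphay : (alpha < +oo)%E by rewrite (le_lt_trans alpha_le1)// ltry.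
split=> [H f Af Lf|H a X a0 AX aX_fin]; last first.
  have aX_level i : superlevel_in (A i) (indic_tuple a X i).
    by apply: superlevel_in_indic => //; exact: ltW.
  rewrite -lower_integralE; last exact: gsc_ge0 sq_gsc _ aX_level.
  apply: H => // i; rewrite inE/=; apply/andP; split; rewrite inE/=;
    last exact: aX_fin.
  by apply: measurable_funM => //; apply: measurable_indic; exact: A_meas.
have f0 i x : 0 <= f i x := (Af i).1 x.
have mf i : measurable_fun setT (f i).
  by have := Lf i; rewrite inE => /andP[]; rewrite inE.
have Nfin i : ('N[mu i]_(p i)%:E[EFin \o f i] < +oo)%E.
  by have := Lf i; rewrite inE => /andP[_]; rewrite inE.
pose N i : R := fine 'N[mu i]_(p i)%:E[EFin \o f i]%E.
have NE i : ('N[mu i]_(p i)%:E[EFin \o f i])%E = (N i)%:E.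
  by rewrite fineK// ge0_fin_numE// Lnorm_ge0.
have N_ge0 i : 0 <= N i by rewrite fine_ge0// Lnorm_ge0.
have lower_ge0 : (0 <= lower_integral nu (sq f))%E.
  rewrite lower_integralE ?integral_ge0// => z *; exact: gsc_ge0 sq_gsc _ Af _.
have [/existsP[i /eqP Ni0]|/existsPn N_neq0] := boolP [exists i, N i == 0].
  by rewrite (wmean_eq0 _ _ Ni0).
have N_gt0 i : 0 < N i by rewrite lt_neqAle eq_sym N_neq0 N_ge0.
apply/lee_mul01Pr; first by rewrite lee_fin wmean_ge0.
move=> c /andP[c0 c1].
have levels i : exists M0, forall M, (M0 <= M)%N -> (0 < M)%N ->
    exists s : nat -> R, s 0%N = 0 /\ forall k, (k < M)%N -> s k < s k.+1 /\
      (((c * N i) / M%:R)%:E <= 'N[mu i]_(p i)%:E[EFin \o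
        (fun x => (s k.+1 - s k) * \1_[set y | s k.+1 <= f i y] x)%R])%E.
  apply: equal_norm_levels => //; first by rewrite mulr_gt0.
  by rewrite NE lte_fin gtr_pMl.
have [M0 {}levels] := choice levels.
(* One number of layers for all indices, positive for the division by M. *)
pose M := (\max_i M0 i).+1.
have {}levels i := levels i M (leqW (leq_bigmax i)) isT.
have [s Hs] := choice levels.
have s0 i : s i 0%N = 0 := (Hs i).1.
have sI i k : (k < M)%N -> s i k < s i k.+1.
  by move=> kM; have [] := (Hs i).2 k kM.
have s_gt0 i k : (k < M)%N -> 0 < s i k.+1.
  move=> kM; rewrite (le_lt_trans _ (sI i k kM))//.
  by apply: levels_ge0 (s0 i) _ => j jk; exact/sI/(ltn_trans jk).
pose a (k : nat) i := s i k.+1 - s i k.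
pose X (k : nat) i := [set x | s i k.+1 <= f i x].
have a_gt0 k i : (k < M)%N -> 0 < a k i by move=> ?; rewrite subr_gt0 sI.
have AX k i : (k < M)%N -> A i (X k i).
  by move=> ?; apply: (Af i).2; exact: s_gt0.
have aX_level k i : (k < M)%N ->
  superlevel_in (A i) (indic_tuple (a k) (X k) i).
  by move=> kM; apply: superlevel_in_indic => //; [exact/ltW/a_gt0|exact: AX].
have le_sq z : (\sum_(k < M) sq (indic_tuple (a k) (X k)) z <= sq f z)%E.
  apply: le_trans (sq_layer_sum A_set0 sq_gsc Af s0 sI z) _.
  apply: (gsc_mono sq_gsc) => // i; last first.
    by move=> x; apply: layer_sum_le => // k kM; exact: sI.
  exact: superlevel_in_layer_sum (A_set0 i) (Af i) (s0 i) (sI i).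
apply: le_trans (le_lower_integral nu le_sq).
have sq_ge0 k z : (k < M)%N -> (0 <= sq (indic_tuple (a k) (X k)) z)%E.
  by move=> kM; apply: (gsc_ge0 sq_gsc) => i; exact: aX_level.
rewrite lower_integralE; last first.
  by move=> z; apply: sume_ge0 => k _; exact: sq_ge0.
rewrite ge0_integral_sum//; last 2 first.
- move=> k; apply: (gsc_meas sq_gsc) => i; [exact/ltW/a_gt0|exact: AX].
- by move=> k z _; exact: sq_ge0.
have -> : (c%:E * (wmean t alpha N)%:E =
    \sum_(k < M) (c / M%:R * wmean t alpha N)%:E)%E.
  rewrite sumEFin sumr_const card_ord -EFinM; congr EFin.
  by rewrite -[RHS]mulr_natr [RHS]mulrAC divfK// pnatr_eq0.
apply: lee_sum => k _.
have aX_fin i : ('N[mu i]_(p i)%:E[EFin \o indic_tuple (a k) (X k) i] < +oo)%E.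
  apply: le_lt_trans (Nfin i); apply: le_Lnorm => //.
    by apply: measurable_funM => //; exact/measurable_indic/A_meas/AX.
  move=> x; rewrite /indic_tuple indic_superlevel.
  rewrite mulr_ge0 ?(ltW (a_gt0 k i (ltn_ord k)))//=.
  have [sf|_] := leP (s i k.+1) (f i x); last by rewrite mulr0.
  rewrite mulr1 (le_trans _ sf)// gerBl.
  by apply: levels_ge0 (s0 i) _ => j jk; exact/sI/(ltn_trans jk).
apply: le_trans (H _ _ (fun i => a_gt0 k i (ltn_ord k))
  (fun i => AX k i (ltn_ord k)) aX_fin).
rewrite lee_fin; apply: wmean_homogeneous_le => //.
  by rewrite divr_gt0.
move=> i; rewrite -lee_fin fineK; last by rewrite ge0_fin_numE// Lnorm_ge0.
by rewrite mulrAC; have [_] := (Hs i).2 k (ltn_ord k).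
Qed.
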